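(* Let $H$ be a connected non-bipartite graph with a maximal independent set $S \subseteq V(H)$, let $T = V(H)\setminus S$, let $G$ be the subgraph of $H$ induced by $T$, and let $B$ be the bipartite graph obtained from $H$ by deleting all edges between vertices of $T$. For distinct $i,j \in T$ let $N_{ij}=\{k \in S : k \sim_B i \text{ and } k \sim_B j\}$. Suppose that (1) for all $ij \in E(G)$: $$\sum_{k \in N_{ij}} \frac{1}{d_B(k)} \geq 1;$$ and (2) for all distinct $i,j\in T$ with $ij \notin E(G)$: $N_{ij} \neq \emptyset$. Then $H$ is $S$-Roth.
   Context: Graphs are finite and simple. For a graph $H$ with adjacency matrix $A(H)$ and diagonal degree matrix $D(H)$, the signless Laplacian is $Q(H)=D(H)+A(H)$, and $\mu(H)$ denotes its smallest eigenvalue. Eigenvectors are real. For a vector $x$ indexed by $V(H)$ and a nonempty $U\subseteq V(H)$, $x(U)$ is the subvector of entries indexed by $U$; $v>0$ (resp. $v<0$) means all entries of $v$ are strictly positive (resp. negative). $d_B(k)$ is the degree of $k$ in $B$, and $k\sim_B i$ means $k$ and $i$ are adjacent in $B$. ''Maximal'' independent set means maximal under inclusion. Definition: let $H$ be a connected graph and $S\subseteq V(H)$ a maximal independent set. $H$ is $S$-Roth if for every eigenvector $x$ of $Q(H)$ corresponding to $\mu(H)$, either $x(S)>0$ and $x(V(H)\setminus S)<0$, or $x(S)<0$ and $x(V(H)\setminus S)>0$. *)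

(* Defs.v *)
From HB Require Import structures.
From mathcomp Require Import all_boot all_order all_algebra.
From mathcomp Require Import reals.

Set Implicit Arguments.
Unset Strict Implicit.
Unset Printing Implicit Defensive.

Import Order.TTheory GRing.Theory Num.Theory.

Local Open Scope ring_scope.

Record sgraph := SGraph {
  vertex :> finType;
  edge : rel vertex;
  edge_sym : symmetric edge;
  edge_irr : irreflexive edge }.

Arguments edge {s}.

Section Graphs.
Variable H : sgraph.

Definition nbrs (x : H) : {set H} := [set y | edge x y].
Definition degree (x : H) : nat := #|nbrs x|.

(* The graph with no vertex satisfies this; it is bipartite. *)
Definition connected : Prop := forall x y : H, connect edge x y.

Definition bipartite : Prop :=
  exists A : {set H}, forall x y : H, edge x y -> (x \in A) != (y \in A).

Definition independent (A : {set H}) : bool :=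
  [forall x in A, forall y in A, ~~ edge x y].

Definition maximal_independent (A : {set H}) : bool := maxset independent A.

Variable U : {set H}.

Definition induced_edge : rel {x : H | x \in U} :=
  fun x y => edge (val x) (val y).

Lemma induced_edge_sym : symmetric induced_edge.
Proof. by move=> x y; rewrite /induced_edge edge_sym. Qed.

Lemma induced_edge_irr : irreflexive induced_edge.
Proof. by move=> x; rewrite /induced_edge edge_irr. Qed.

Definition induced : sgraph := SGraph induced_edge_sym induced_edge_irr.

Definition del_inner_edge : rel H :=
  fun x y => edge x y && ~~ ((x \in U) && (y \in U)).

Lemma del_inner_edge_sym : symmetric del_inner_edge.
Proof. by move=> x y; rewrite /del_inner_edge edge_sym [(x \in U) && _]andbC. Qed.

Lemma del_inner_edge_irr : irreflexive del_inner_edge.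
Proof. by move=> x; rewrite /del_inner_edge edge_irr. Qed.

(* H with all edges between two vertices of U deleted; the vertex set is
   still that of H. *)
Definition del_inner : sgraph := SGraph del_inner_edge_sym del_inner_edge_irr.

End Graphs.

Section SignlessLaplacian.
Variables (R : realType) (H : sgraph).

(* Rows and columns are indexed by V(H) through enum_rank / enum_val. *)
Definition adj_mx : 'M[R]_#|H| :=
  \matrix_(i, j) (edge (enum_val i) (enum_val j))%:R.

Definition deg_mx : 'M[R]_#|H| :=
  diag_mx (\row_i (degree (enum_val i))%:R).

Definition signless_laplacian : 'M[R]_#|H| := deg_mx + adj_mx.

Definition entry (x : 'rV[R]_#|H|) (k : H) : R := x 0 (enum_rank k).

End SignlessLaplacian.

Definition smallest_eigenvalue (R : realType) (n : nat)
    (M : 'M[R]_n) (a : R) : Prop :=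
  eigenvalue M a /\ forall b : R, eigenvalue M b -> a <= b.

(* Row eigenvectors, as for the library's eigenvalue; the matrices of interest
   are symmetric. *)
Definition eigenvector (R : realType) (n : nat)
    (M : 'M[R]_n) (a : R) (x : 'rV[R]_n) : Prop :=
  x *m M = a *: x /\ x != 0.

Definition Roth (R : realType) (H : sgraph) (S : {set H}) : Prop :=
  forall (mu : R) (x : 'rV[R]_#|H|),
    smallest_eigenvalue (signless_laplacian R H) mu ->
    eigenvector (signless_laplacian R H) mu x ->
       ((forall k, k \in S -> 0 < entry x k) /\
        (forall k, k \in ~: S -> entry x k < 0))
    \/ ((forall k, k \in S -> entry x k < 0) /\
        (forall k, k \in ~: S -> 0 < entry x k)).

(* B is a graph on the vertex set of H; i and j are meant to lie in ~: S. *)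
Definition common_nbrs (H : sgraph) (S : {set H}) (i j : H) : {set H} :=
  let B := del_inner (~: S) in
  [set k in S | @edge B k i && @edge B k j].

(* Main.v *)
Require Import Defs.
From HB Require Import structures.
From mathcomp Require Import all_boot all_order all_algebra.
From mathcomp Require Import reals.
From mathcomp Require Import ring.
From mathcomp Require Import sesquilinear spectral complex.

Set Implicit Arguments.
Unset Strict Implicit.
Unset Printing Implicit Defensive.

Import Order.TTheory GRing.Theory Num.Theory.
Local Open Scope ring_scope.

(** Let mu be the smallest eigenvalue of Q(H) and x an eigenvector for it. The
    matrix Q(H) - mu is positive semidefinite ([shifted_laplacian_psd]) and kills
    x. Since S is independent, its block on S is diagonal, with entries d_k - mu;
    they are positive, because a semidefinite matrix with a nonpositive diagonal
    entry has a zero row there ([psd_diag_gt0]), whereas every vertex of H has a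
    neighbour. So the coordinates in S can be eliminated: the vector x(T) is in
    the kernel of the Schur complement on T, which is again positive semidefinite
    ([schur_elim], [schur_psd]).

    For distinct i and j in T, the (i, j) entry of this complement is
    a_ij - (sum over k in N_ij of 1 / (d_k - mu)), a_ij being the adjacency entry
    ([schur_shifted_laplacian]). Since H is connected and not bipartite, mu > 0
    ([eigenvalue_gt0]), so 1 / (d_k - mu) > 1 / d_k. Hypothesis (1) then
    makes the entry negative when ij is an edge, and hypothesis (2) when it is
    not. A positive semidefinite matrix with negative off-diagonal entries has
    only kernel vectors of constant strict sign ([perron_kernel], a form of the
    Perron-Frobenius theorem), which settles the sign of x on T. Finally, for k
    in S, the k-th eigenvalue equation reads
    (d_k - mu) x_k = - (sum of x_j over the neighbours j of k), and these all lie
    in T, so x_k has the opposite sign. *)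

(** * The Rayleigh principle for real symmetric matrices *)

Section Rayleigh.
Local Open Scope sesquilinear_scope.

(** The spectral theorem is available over an algebraically closed field, so
    the matrix is diagonalised over R[i] in a unitary basis; the eigenvalues
    being real, they are eigenvalues over R, and the form is a sum of
    d_i |w_i|^2 in the new coordinates w. *)
Lemma rayleigh_min (R : rcfType) n (M : 'M[R]_n) (a : R) :
  M^T = M -> (forall b, eigenvalue M b -> a <= b) ->
  forall y : 'rV[R]_n, a * \sum_i y 0 i ^+ 2 <= \sum_i (y *m M) 0 i * y 0 i.
Proof.
move=> symM lea y.
pose f : {rmorphism R -> R[i]} := real_complex R.
have fJ m p (B : 'M[R]_(m, p)) : (map_mx f B)^t* = map_mx f B^T.
  by apply/matrixP=> i j; rewrite !mxE; apply: conjc_real.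
have hermM : map_mx f M \is hermsymmx.
  by apply/is_hermitianmxP; rewrite expr0 scale1r fJ symM.
have /orthomx_spectralP := hermitian_normalmx hermM.
have /mxOverP := hermitian_spectral_diag_real hermM.
set P := spectralmx _; set d := spectral_diag _ => real_d defM.
have unitaryP : P \is unitarymx := spectral_unitarymx _.
have unitP : P \in unitmx := unitarymx_unit unitaryP.
have le_d i : f a <= d 0 i.
  have /complex_realP[b def_b] := real_d 0 i.
  rewrite def_b lecR; apply: lea; rewrite -(eigenvalue_map f) /= -def_b.
  apply/eigenvalueP; exists (row i P).
    by rewrite defM rowE !mulmxA mulmxK // -[delta_mx 0 i *m diag_mx d]rowE row_diag_mx
       -scalemxAl.
  rewrite rowE mulmx_free_eq0 ?row_free_unit //.
  by apply/eqP=> /matrixP/(_ 0 i)/eqP; rewrite !mxE !eqxx oner_eq0.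
rewrite invmx_unitary // in defM.
pose w := map_mx f y *m P^t*.
have wJ : w^t* = P *m map_mx f y^T.
  by rewrite /w trmx_mul map_mxM trmxCK fJ.
have normy : f (\sum_i y 0 i ^+ 2) = \sum_i w 0 i * (w 0 i)^*.
  transitivity ((w *m w^t*) 0 0); last first.
    by rewrite mxE; apply: eq_bigr => i _; rewrite !mxE.
  rewrite wJ mulmxA mulmxKtV // -map_mxM mxE; congr (f _).
  by rewrite mxE; apply: eq_bigr => i _; rewrite mxE expr2.
have quady : f (\sum_i (y *m M) 0 i * y 0 i) =
    \sum_i d 0 i * (w 0 i * (w 0 i)^*).
  transitivity ((w *m diag_mx d *m w^t*) 0 0); last first.
    by rewrite mxE; apply: eq_bigr => i _; rewrite mul_mx_diag !mxE mulrAC mulrC.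
  rewrite wJ /w -!mulmxA (mulmxA (diag_mx d)) (mulmxA (P^t*)) (mulmxA (P^t*)) -defM mulmxA.
  rewrite -!map_mxM mxE; congr (f _).
  by rewrite mxE; apply: eq_bigr => i _; rewrite [y^T _ _]mxE.
rewrite -lecR rmorphM /= -/f normy quady mulr_sumr ler_sum // => i _.
by rewrite ler_wpM2r ?le_d // mul_conjC_ge0.
Qed.

End Rayleigh.

(** * Positive semidefinite forms: kernels and elimination of variables *)

Section QuadraticForms.
Variables (R : realFieldType) (I : finType).
Implicit Types (m : I -> I -> R) (y : I -> R) (P : pred I).

Definition psd_on P m :=
  forall y, 0 <= \sum_(i | P i) y i * \sum_(j | P j) m i j * y j.

(** At an index i with x i = 0, the i-th equation is a sum of nonpositive terms,
    which forces every other entry of x to vanish as well. *)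
Lemma perron_kernel_ge0 P m x :
  (forall i j, P i -> P j -> i != j -> m i j < 0) ->
  (forall i, P i -> \sum_(j | P j) m i j * x j = 0) ->
  (forall i, P i -> 0 <= x i) ->
  (exists2 i, P i & x i != 0) -> forall i, P i -> 0 < x i.
Proof.
move=> m_lt0 mx0 x_ge0 [j Pj xj_neq0] i Pi.
rewrite lt_neqAle x_ge0 // andbT eq_sym; apply: contraNneq xj_neq0 => xi0.
have [<- |neq_ij] := eqVneq i j; first by rewrite xi0.
have le0 k : P k -> 0 <= - (m i k * x k).
  move=> Pk; have [<- |neq_ik] := eqVneq i k; first by rewrite xi0 mulr0 oppr0.
  by rewrite -mulNr mulr_ge0 ?x_ge0 // oppr_ge0 ltW ?m_lt0.
have /eqP: \sum_(k | P k) - (m i k * x k) = 0 by rewrite sumrN mx0 ?oppr0.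
rewrite psumr_eq0 // => /allP/(_ j); rewrite mem_index_enum Pj => /(_ isT).
by rewrite oppr_eq0 mulf_eq0 lt_eqF ?m_lt0.
Qed.

(** Passing from x to its entrywise absolute value can only decrease the form,
    since the off-diagonal coefficients are negative. The form is already at
    its minimum 0 at x, so nothing is lost: all products x i * x j are
    nonnegative. *)
Lemma perron_kernel P m x :
  psd_on P m ->
  (forall i j, P i -> P j -> i != j -> m i j < 0) ->
  (forall i, P i -> \sum_(j | P j) m i j * x j = 0) ->
  (exists2 i, P i & x i != 0) ->
  (forall i, P i -> 0 < x i) \/ (forall i, P i -> x i < 0).
Proof.
move=> psd_m m_lt0 mx0 [k Pk xk_neq0].
(* The contribution of (i, j) to the form at x minus the form at |x|. *)
pose gap i j := m i j * (x i * x j - `|x i| * `|x j|).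
have gap_ge0 i j : P i -> P j -> 0 <= gap i j.
  move=> Pi Pj; rewrite /gap; have [<- |neq_ij] := eqVneq i j.
    by rewrite -!expr2 real_normK ?num_real // subrr mulr0.
  by rewrite mulr_le0 ?subr_le0 -?normrM ?ler_norm // ltW ?m_lt0.
have gap_sum : \sum_(i | P i) \sum_(j | P j) gap i j <= 0.
  have := psd_m (fun i => `|x i|); rewrite -oppr_le0; congr (_ <= _).
  rewrite -sumrN; apply: eq_bigr => i Pi.
  have -> : \sum_(j | P j) gap i j = x i * (\sum_(j | P j) m i j * x j)
      - `|x i| * (\sum_(j | P j) m i j * `|x j|).
    by rewrite !mulr_sumr -sumrB; apply: eq_bigr => j _; rewrite /gap; ring.
  by rewrite mx0 // mulr0 sub0r.
have gap0 i j : P i -> P j -> gap i j = 0.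
  move=> Pi Pj; have row_ge0 l : P l -> 0 <= \sum_(j | P j) gap l j.
    by move=> Pl; apply: sumr_ge0 => h; apply: gap_ge0.
  have : \sum_(l | P l) \sum_(j | P j) gap l j == 0.
    by rewrite eq_le gap_sum sumr_ge0.
  rewrite psumr_eq0 // => /allP/(_ i); rewrite mem_index_enum Pi => /(_ isT).
  rewrite psumr_eq0 => [/allP/(_ j)|h]; last exact: gap_ge0.
  by rewrite mem_index_enum Pj => /(_ isT)/eqP.
have same_sign i : P i -> 0 <= x k * x i.
  move=> Pi; have [<- |neq_ki] := eqVneq k i; first by rewrite -expr2 sqr_ge0.
  have /eqP := gap0 _ _ Pk Pi; rewrite /gap mulf_eq0 lt_eqF ?m_lt0 //= subr_eq0.
  by move/eqP->; rewrite mulr_ge0.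
case: (ltrgtP (x k) 0) xk_neq0 => // [xk_lt0|xk_gt0] _; [right|left].
  move=> i Pi; rewrite -oppr_gt0.
  apply: (perron_kernel_ge0 (x := fun i => - x i) m_lt0) Pi => [{}i Pi|{}i Pi|].
  - by under eq_bigr do rewrite mulrN; rewrite sumrN mx0 ?oppr0.
  - by have := same_sign _ Pi; rewrite nmulr_rge0 // oppr_ge0.
  - by exists k; rewrite // oppr_eq0 lt_eqF.
apply: (perron_kernel_ge0 m_lt0) => // [i Pi|]; last by exists k; rewrite // gt_eqF.
by have := same_sign _ Pi; rewrite pmulr_rge0.
Qed.

Lemma sum_delta (k : I) y : \sum_i (i == k)%:R * y i = y k.
Proof.
rewrite (bigD1 k) //= eqxx mul1r big1 ?addr0 // => i /negPf->.
by rewrite mul0r.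
Qed.

(** With a zero or negative entry m k k, the form at t e_k + e_i would be bounded
    above by the affine function 2 t m k i + m i i, which takes negative
    values. *)
Lemma psd_diag_gt0 m k i :
  psd_on predT m -> (forall u v, m u v = m v u) -> m k i != 0 -> 0 < m k k.
Proof.
move=> psd_m sym_m mki_neq0; rewrite ltNge; apply/negP=> mkk_le0.
(* The parameter at which 2 t m k i + m i i equals -1. *)
pose t := - (m i i + 1) / (2 * m k i).
have := psd_m (fun u => t * (u == k)%:R + (u == i)%:R).
pose r u := t * m u k + m u i.
have rowE u : \sum_v m u v * (t * (v == k)%:R + (v == i)%:R) = r u.
  rewrite /r -(sum_delta k (m u)) -(sum_delta i (m u)) mulr_sumr -big_split /=.
  by apply: eq_bigr => v _; ring.
under eq_bigr do rewrite rowE.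
have -> : \sum_u (t * (u == k)%:R + (u == i)%:R) * r u = t * r k + r i.
  rewrite -(sum_delta k r) -(sum_delta i r) mulr_sumr -big_split /=.
  by apply: eq_bigr => u _; ring.
have -> : t * r k + r i = t ^+ 2 * m k k - 1.
  by rewrite /r (sym_m i k) /t; field.
by rewrite leNgt ltrBlDr add0r (le_lt_trans _ ltr01) // mulr_ge0_le0 ?sqr_ge0.
Qed.

(** ** Schur complement of a diagonal block *)

Section SchurComplement.
Variables (S : {set I}) (m : I -> I -> R).
Hypothesis m_diag : forall k, k \in S -> m k k != 0.
Hypothesis m_off : forall k l, k \in S -> l \in S -> k != l -> m k l = 0.

Definition schur i j := m i j - \sum_(k in S) m i k * m k j / m k k.

Lemma schur_row y k : k \in S ->
  \sum_j m k j * y j = m k k * y k + \sum_(j | j \notin S) m k j * y j.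
Proof.
move=> Sk; rewrite (bigID (mem S)) /=; congr (_ + _).
rewrite (bigD1 k) //= big1 ?addr0 // => l /andP[Sl neq_lk].
by rewrite m_off ?mul0r // eq_sym.
Qed.

(** The equations indexed by S determine y on S from its values outside S;
    substituting them in the other equations gives the Schur complement. *)
Lemma schur_elim y : (forall k, k \in S -> \sum_j m k j * y j = 0) ->
  forall i, \sum_j m i j * y j = \sum_(j | j \notin S) schur i j * y j.
Proof.
move=> my0 i; rewrite (bigID (mem S)) /= addrC.
have yE k : k \in S -> y k = - (\sum_(j | j \notin S) m k j * y j) / m k k.
  move=> Sk; have /eqP := my0 k Sk; rewrite schur_row // addr_eq0 => /eqP <-.
  by rewrite mulrAC mulfV ?mul1r ?m_diag.
under [RHS]eq_bigr do rewrite mulrBl; rewrite sumrB; congr (_ + _).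
under [X in _ = - X]eq_bigr do rewrite mulr_suml.
rewrite exchange_big -sumrN; apply: eq_bigr => k Sk /=.
rewrite yE // mulrA mulrN mulr_sumr mulNr mulr_suml; congr (- _).
by apply: eq_bigr => j _; ring.
Qed.

(** The value of the Schur complement at z is the value of m at the extension of
    z to S that solves the equations indexed by S. *)
Lemma schur_psd : psd_on predT m -> psd_on (fun i => i \notin S) schur.
Proof.
move=> psd_m z.
pose y i := if i \in S then - (\sum_(j | j \notin S) m i j * z j) / m i i else z i.
have yE j : j \notin S -> y j = z j by rewrite /y => /negPf->.
have my0 k : k \in S -> \sum_j m k j * y j = 0.
  move=> Sk; rewrite schur_row // {1}/y Sk mulrCA mulfV ?m_diag // mulr1.
  by rewrite [X in _ + X](eq_bigr (fun j => m k j * z j)) ?addNr // => j /yE->.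
have := psd_m y; congr (0 <= _); rewrite (bigID (mem S)) /= big1 ?add0r.
  apply: eq_bigr => i Si; rewrite yE // schur_elim //; congr (_ * _).
  by apply: eq_bigr => j Sj; rewrite yE.
by move=> k Sk; rewrite my0 ?mulr0.
Qed.

End SchurComplement.
End QuadraticForms.

(** * The quadratic form of the signless Laplacian *)

Section ShiftedLaplacian.
Variables (R : realType) (H : sgraph).
Implicit Types (mu : R) (u v : H) (y : H -> R).

(** The entries of Q(H) - mu, indexed directly by pairs of vertices; mu = 0
    gives Q(H) itself. *)
Definition shifted_laplacian mu u v : R :=
  (u == v)%:R * ((degree u)%:R - mu) + (edge u v)%:R.

Lemma shifted_laplacianC mu u v :
  shifted_laplacian mu u v = shifted_laplacian mu v u.
Proof.
rewrite /shifted_laplacian edge_sym eq_sym.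
by case: eqP => [-> //|_]; rewrite !mul0r.
Qed.

Lemma signless_laplacian_row (x : 'rV[R]_#|H|) v :
  entry (x *m signless_laplacian R H) v =
  \sum_u shifted_laplacian 0 v u * entry x u.
Proof.
rewrite /entry mxE (reindex enum_rank); last exact/onW_bij/enum_rank_bij.
apply: eq_bigr => u _; rewrite !mxE !enum_rankK (inj_eq enum_rank_inj) mulrC.
rewrite shifted_laplacianC /shifted_laplacian subr0.
by rewrite mulr_natl.
Qed.

Lemma shifted_laplacianE mu y v :
  \sum_u shifted_laplacian mu v u * y u =
  \sum_u shifted_laplacian 0 v u * y u - mu * y v.
Proof.
rewrite -(sum_delta v y) mulr_sumr -sumrB; apply: eq_bigr => u _.
by rewrite /shifted_laplacian eq_sym; ring.
Qed.

Lemma shifted_laplacian_eigen mu x v :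
  eigenvector (signless_laplacian R H) mu x ->
  \sum_u shifted_laplacian mu v u * entry x u = 0.
Proof.
case=> xQ _; rewrite shifted_laplacianE -signless_laplacian_row xQ.
by rewrite /entry mxE subrr.
Qed.

Lemma signless_laplacian_sym : (signless_laplacian R H)^T = signless_laplacian R H.
Proof.
by rewrite /signless_laplacian linearD /= tr_diag_mx; congr (_ + _);
  apply/matrixP=> i j; rewrite !mxE edge_sym.
Qed.

Lemma shifted_laplacian_psd mu :
  smallest_eigenvalue (signless_laplacian R H) mu ->
  psd_on predT (shifted_laplacian mu).
Proof.
case=> _ le_mu y; pose x : 'rV[R]_#|H| := \row_i y (enum_val i).
have xE u : entry x u = y u by rewrite /entry mxE enum_rankK.
have := rayleigh_min signless_laplacian_sym le_mu x.
rewrite (reindex enum_rank); last exact/onW_bij/enum_rank_bij.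
rewrite [leRHS](reindex enum_rank); last exact/onW_bij/enum_rank_bij.
rewrite -subr_ge0 mulr_sumr -sumrB; congr (0 <= _); apply: eq_bigr => v _ /=.
rewrite -/(entry x v) -/(entry _ v) signless_laplacian_row xE.
by rewrite (shifted_laplacianE mu); under eq_bigr do rewrite xE; ring.
Qed.

Lemma degree_sum u : (degree u)%:R = \sum_v (edge u v)%:R :> R.
Proof.
rewrite /degree -sum1_card natr_sum big_mkcond.
by apply: eq_bigr => v _; rewrite inE; case: (edge u v).
Qed.

(** Each edge appears in both orientations in the right-hand side, whence the
    factor 2. *)
Lemma signless_laplacian_form y :
  2 * \sum_u y u * \sum_v shifted_laplacian 0 u v * y v =
  \sum_u \sum_v (edge u v)%:R * (y u + y v) ^+ 2.
Proof.
pose s u v : R := (edge u v)%:R * (y u + y v).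
have lapE u : y u * \sum_v shifted_laplacian 0 u v * y v = \sum_v s u v * y u.
  rewrite -mulr_suml mulrC; congr (_ * _); rewrite /s /shifted_laplacian.
  under eq_bigr do rewrite mulrDl -mulrA; rewrite big_split /=.
  under [RHS]eq_bigr do rewrite mulrDr; rewrite [RHS]big_split /=; congr (_ + _).
  under eq_bigr do rewrite eq_sym; rewrite (sum_delta u (fun v => _ * y v)).
  by rewrite subr0 degree_sum mulr_suml.
under eq_bigr do rewrite lapE.
rewrite mulr_natl mulr2n {2}exchange_big -big_split; apply: eq_bigr => u _ /=.
by rewrite -big_split; apply: eq_bigr => v _; rewrite /s edge_sym /=; ring.
Qed.

(** By [signless_laplacian_form], an eigenvector x for mu <= 0 satisfies
    x u = - x v along every edge. By connectedness it vanishes nowhere, and then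
    its sign is a proper 2-colouring of H. *)
Lemma eigenvalue_gt0 mu x :
  connected H -> ~ bipartite H ->
  eigenvector (signless_laplacian R H) mu x -> 0 < mu.
Proof.
move=> Hconn Hnbip eig_x; rewrite ltNge; apply/negP=> mu_le0; apply: Hnbip.
pose y := entry x.
have eig v : \sum_u shifted_laplacian 0 v u * y u = mu * y v.
  by apply/eqP; rewrite -subr_eq0 -shifted_laplacianE (shifted_laplacian_eigen _ eig_x).
have term_ge0 u v : 0 <= (edge u v)%:R * (y u + y v) ^+ 2.
  by rewrite mulr_ge0 ?sqr_ge0.
have opp u v : edge u v -> y v = - y u.
  move=> uv; have: \sum_u \sum_v (edge u v)%:R * (y u + y v) ^+ 2 == 0.
    rewrite eq_le; apply/andP; split; last by do 2 apply: sumr_ge0 => ? _.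
    rewrite -signless_laplacian_form pmulr_rle0 // sumr_le0 // => w _.
    by rewrite eig mulrCA mulr_le0_ge0 // -expr2 sqr_ge0.
  rewrite psumr_eq0 => [/allP/(_ u)|w _]; last exact: sumr_ge0.
  rewrite mem_index_enum => /(_ isT) /=.
  rewrite psumr_eq0 // => /allP/(_ v); rewrite mem_index_enum => /(_ isT) /=.
  by rewrite uv mul1r sqrf_eq0 addrC addr_eq0 => /eqP.
have y_neq0 u : y u != 0.
  case: eig_x => _; apply: contraNneq => yu0; apply/eqP/rowP=> i; rewrite mxE.
  have cl : closed edge [pred v | y v == 0].
    by move=> v w /opp; rewrite !inE => ->; rewrite oppr_eq0.
  have := closed_connect cl (Hconn u (enum_val i)); rewrite !inE yu0 eqxx.
  by rewrite /y /entry enum_valK => /esym/eqP.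
exists [set u | 0 < y u] => u v /opp yv; rewrite !inE yv oppr_gt0.
by case: ltrgtP (y_neq0 u).
Qed.

End ShiftedLaplacian.

(** * Elimination of the independent set *)

Section BipartitePart.
Variables (H : sgraph) (S : {set H}).

Lemma nonbipartite_has_nbr :
  connected H -> ~ bipartite H -> forall u : H, exists v, edge u v.
Proof.
move=> Hconn Hnbip u; case: (pickP (edge u)) => [v uv|no_nbr]; first by exists v.
have cl : closed edge (pred1 u).
  move=> v w vw; rewrite !inE.
  have [eq_vu|_] := eqVneq v u; first by rewrite eq_vu no_nbr in vw.
  by have [eq_wu|//] := eqVneq w u; rewrite eq_wu edge_sym no_nbr in vw.
have all_u v : v = u.
  by have := closed_connect cl (Hconn u v); rewrite !inE eqxx => /esym/eqP.
by case: Hnbip; exists set0 => v w; rewrite (all_u v) no_nbr.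
Qed.

Lemma del_inner_edgeE k u : k \in S -> @edge (del_inner (~: S)) k u = edge k u.
Proof. by move=> Sk; rewrite /= /del_inner_edge !inE Sk andbT. Qed.

Lemma degree_del_inner k : k \in S -> @degree (del_inner (~: S)) k = degree k.
Proof.
by move=> Sk; apply: eq_card => u; rewrite !inE del_inner_edgeE.
Qed.

Lemma common_nbrsE i j k :
  (k \in common_nbrs S i j) = [&& k \in S, edge k i & edge k j].
Proof.
by rewrite inE; case Sk: (k \in S); rewrite ?andbF //= -!del_inner_edgeE.
Qed.

(** A neighbour k of i and j in S acts, once eliminated, as a negative
    coupling between i and j, of strength the inverse of its diagonal entry. *)
Lemma schur_shifted_laplacian (R : realType) (mu : R) i j :
  i \notin S -> j \notin S -> i != j ->
  schur S (shifted_laplacian mu) i j =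
  (edge i j)%:R - \sum_(k in common_nbrs S i j) (shifted_laplacian mu k k)^-1.
Proof.
move=> Si Sj neq_ij; rewrite /schur {1}/shifted_laplacian (negPf neq_ij) mul0r add0r.
congr (_ - _); rewrite big_mkcond [RHS]big_mkcond; apply: eq_bigr => k _.
rewrite common_nbrsE; case Sk: (k \in S) => //=.
have offE u : u \notin S -> shifted_laplacian mu k u = (edge k u)%:R.
  move=> Su; rewrite /shifted_laplacian; have [eq_ku|_] := eqVneq k u.
    by rewrite -eq_ku Sk in Su.
  by rewrite mul0r add0r.
rewrite shifted_laplacianC (offE i) // (offE j) //.
by case: (edge k i); case: (edge k j); rewrite ?mul0r ?mulr0 ?mul0r ?mul1r.
Qed.

End BipartitePart.

Theorem theorem6p2 (R : realType) (H : sgraph) (S : {set H})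
    (Hconn : connected H) (Hnbip : ~ bipartite H)
    (HS : maximal_independent S) :
  let T := ~: S in
  let G := induced T in
  let B := del_inner T in
  (forall i j : G, edge i j ->
     1 <= \sum_(k in common_nbrs S (val i) (val j))
            ((@degree B k)%:R : R)^-1) ->
  (forall i j : G, i != j -> ~~ edge i j ->
     common_nbrs S (val i) (val j) != set0) ->
  Roth R S.
Proof.
move=> T G B adj_sum nonadj_common mu x min_mu eig_x.
have mu_gt0 : 0 < mu := eigenvalue_gt0 Hconn Hnbip eig_x.
pose m := @shifted_laplacian R H mu.
have psd_m : psd_on predT m := shifted_laplacian_psd min_mu.
have mx0 u : \sum_v m u v * entry x v = 0 := shifted_laplacian_eigen u eig_x.
have indS k l : k \in S -> l \in S -> ~~ edge k l.
  by case/maxsetP: HS => /forall_inP ind _ /ind/forall_inP; apply.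
have mE u v : u != v -> m u v = (edge u v)%:R.
  by move=> neq_uv; rewrite /m /shifted_laplacian (negPf neq_uv) mul0r add0r.
have edge_neq u v : edge u v -> u != v.
  by move=> uv; apply: contraTneq uv => ->; rewrite edge_irr.
have has_nbr := nonbipartite_has_nbr Hconn Hnbip.
have m_diag u : m u u = (degree u)%:R - mu.
  by rewrite /m /shifted_laplacian eqxx mul1r edge_irr addr0.
have m_gt0 u : 0 < m u u.
  have [v uv] := has_nbr u; apply: (psd_diag_gt0 (i := v) psd_m).
    exact: shifted_laplacianC.
  by rewrite mE ?edge_neq // uv oner_eq0.
have m_diag_neq0 k : k \in S -> m k k != 0 by rewrite gt_eqF.
have m_off k l : k \in S -> l \in S -> k != l -> m k l = 0.
  by move=> Sk Sl /mE->; rewrite (negPf (indS _ _ Sk Sl)).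
have schur_lt0 i j : i \notin S -> j \notin S -> i != j -> schur S m i j < 0.
  move=> Si Sj neq_ij; rewrite schur_shifted_laplacian // subr_lt0.
  have [Ti Tj] : i \in T /\ j \in T by rewrite !inE.
  pose a : G := exist _ i Ti; pose b : G := exist _ j Tj.
  have sum_ge : (edge i j)%:R <= \sum_(k in common_nbrs S i j) ((@degree B k)%:R : R)^-1.
    case ij: (edge i j); first exact: (adj_sum a b).
    by apply: sumr_ge0 => k _; rewrite invr_ge0 ler0n.
  have common_neq0 : common_nbrs S i j != set0.
    case ij: (edge i j); last exact: (nonadj_common a b neq_ij (negbT ij)).
    apply: contraTneq sum_ge => ->.
    by rewrite ij big_set0 -ltNge ltr01.
  (* As mu > 0, each 1 / (d_k - mu) exceeds 1 / d_k strictly. *)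
  apply: (le_lt_trans sum_ge); apply: ltr_sum.
    by have /set0Pn[k Nk] := common_neq0; apply/hasP; exists k; rewrite ?mem_index_enum.
  move=> k; rewrite common_nbrsE => /and3P[Sk _ _].
  rewrite degree_del_inner // -/(m k k) ltf_pV2 ?posrE ?m_gt0 //.
    by rewrite m_diag gtrBl.
  by rewrite (lt_trans (m_gt0 k)) // m_diag gtrBl.
have schur_x i : \sum_(j | j \notin S) schur S m i j * entry x j = 0.
  by rewrite -(schur_elim m_diag_neq0 m_off).
have x_row k : k \in S ->
    m k k * entry x k = - \sum_(j | j \notin S) (edge k j)%:R * entry x j.
  move=> Sk; have /eqP := mx0 k; rewrite (schur_row m_off) // addr_eq0 => /eqP->.
  congr (- _); apply: eq_bigr => j Sj; rewrite mE //.
  by apply: contraNneq Sj => <-.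
have x_T_neq0 : exists2 i, i \notin S & entry x i != 0.
  apply/exists_inP/contraT; rewrite negb_exists_in => /forall_inP xT0.
  have xT i : i \notin S -> entry x i = 0 by move=> /xT0/negPn/eqP.
  case: eig_x => _ /eqP[]; apply/rowP=> i; rewrite mxE -(enum_valK i) -/(entry x _).
  have [Si|/xT//] := boolP (enum_val i \in S).
  apply/eqP; rewrite -(mulrI_eq0 _ (mulfI (m_diag_neq0 _ Si))) x_row // big1 ?oppr0 //.
  by move=> j /xT->; rewrite mulr0.
have T_nbr k : k \in S -> exists2 j, j \notin S & edge k j.
  move=> Sk; have [j kj] := has_nbr k; exists j => //.
  by apply: contraL kj; apply: indS.
have sum_gt0 (y : H -> R) k : (forall j, j \notin S -> 0 < y j) -> k \in S ->
    0 < \sum_(j | j \notin S) (edge k j)%:R * y j.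
  move=> y_gt0 /T_nbr[j Sj kj]; rewrite (bigD1 j) //= kj mul1r ltr_pwDl ?y_gt0 //.
  by apply: sumr_ge0 => l /andP[Sl _]; rewrite mulr_ge0 // ltW ?y_gt0.
have [x_gt0|x_lt0] := perron_kernel (schur_psd m_diag_neq0 m_off psd_m) schur_lt0
  (fun i _ => schur_x i) x_T_neq0.
  right; split=> k; last by rewrite inE => /x_gt0.
  move=> Sk; rewrite -(pmulr_rlt0 _ (m_gt0 k)) x_row // oppr_lt0.
  exact: sum_gt0.
left; split=> k; last by rewrite inE => /x_lt0.
move=> Sk; rewrite -(pmulr_rgt0 _ (m_gt0 k)) x_row // -sumrN.
under eq_bigr do rewrite -mulrN.
by apply: (sum_gt0 (fun j => - entry x j)) => // j /x_lt0; rewrite oppr_gt0.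
Qed.
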